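(* Consider a pullback diagram of commutative rings $i_1:R\to R_1$, $i_2:R\to R_2$, $j_1:R_1\to R_0$, $j_2:R_2\to R_0$ with $i_1$ surjective, and let $n\ge 0$ be an integer. Let $\mathscr{X}$ be a class of $R$-modules satisfying the property $( * )$: for every module $M\in\mathscr{X}_1$ there exists an exact sequence $0\to K\to R^k\to M\to 0$ with $k$ a non-negative integer and $K\in\mathscr{X}$. For $i=1,2$ let $\mathscr{Y}^i$ be a class of $R_i$-modules such that ${}^{R_i\otimes}\mathscr{X}_k$ is a subclass of $\mathscr{Y}^i_k$ for every integer $k\ge 0$. Suppose that for each $M\in\mathscr{X}_n$, $\mathrm{Tor}_j^R(R_i,M)$ is in $\mathscr{Y}^i_{n+1-j}$ for $1\le j\le n+1$ and $i=1,2$. Then $R$ is $n$-$\mathscr{X}$-coherent if $R_i$ is $n$-$\mathscr{Y}^i$-coherent for $i=1,2$.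
   Context: Rings are commutative with identity. The commutative square is a pullback diagram if $R=\ker(j_1\circ p_1-j_2\circ p_2)$, i.e. $R=\{(a,b)\in R_1\times R_2 : j_1(a)=j_2(b)\}$, where $p_1,p_2$ are the projections onto $R_1$, $R_2$ and $i_1,i_2$ are their restrictions to $R$. For an integer $k\ge 0$, a module $M$ is $k$-presented if there is an exact sequence $F_k\to\cdots\to F_0\to M\to 0$ with each $F_i$ a finitely generated free module (over the ring in question). For a class $\mathscr{X}$ of modules, $\mathscr{X}_k$ denotes the class of $k$-presented modules in $\mathscr{X}$ (similarly $\mathscr{Y}^i_k$, over $R_i$). ${}^{R_i\otimes}\mathscr{X}_k$ denotes the class of $R_i$-modules $R_i\otimes_R N$ with $N\in\mathscr{X}_k$. For a class $\mathscr{X}$ of $R$-modules, the ring $R$ is $n$-$\mathscr{X}$-coherent if every $R$-module in $\mathscr{X}_n$ is in $\mathscr{X}_{n+1}$ (similarly for $R_i$ and $\mathscr{Y}^i$). *)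

(* Defs.v *)
From HB Require Import structures.
From mathcomp Require Import all_boot all_order all_algebra finmap.
From mathcomp Require Import generic_quotient ring_quotient.
From mathcomp Require Import boolp classical_sets functions cardinality fsbigop.

Set Implicit Arguments.
Unset Strict Implicit.
Unset Printing Implicit Defensive.

Import GRing.Theory.

Local Open Scope classical_set_scope.
Local Open Scope ring_scope.

Record submodule (R : pzRingType) (V : lmodType R) := Submodule {
  scarrier :> V -> Prop;
  submodule0 : scarrier 0;
  submoduleD : forall x y, scarrier x -> scarrier y -> scarrier (x + y);
  submoduleZ : forall a x, scarrier x -> scarrier (a *: x) }.

Definition smem (R : pzRingType) (V : lmodType R) (W : submodule V) : V -> bool :=
  fun x => `[< W x >].

Lemma smemP (R : pzRingType) (V : lmodType R) (W : submodule V) x :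
  reflect (W x) (x \in smem W).
Proof. exact: asboolP. Qed.

Lemma smem_closed (R : pzRingType) (V : lmodType R) (W : submodule V) :
  subsemimod_closed (smem W).
Proof.
split; first split.
- by apply/smemP; exact: submodule0.
- by move=> x y /smemP Wx /smemP Wy; apply/smemP; exact: submoduleD.
- by move=> a x /smemP Wx; apply/smemP; exact: submoduleZ.
Qed.

HB.instance Definition _ (R : pzRingType) (V : lmodType R) (W : submodule V) :=
  GRing.isSubmodClosed.Build R V (smem W) (smem_closed W).

Definition submod (R : pzRingType) (V : lmodType R) (W : submodule V) : Type :=
  {x : V | smem W x}.

HB.instance Definition _ (R : pzRingType) (V : lmodType R) (W : submodule V) :=
  SubChoice.on (submod W).
HB.instance Definition _ (R : pzRingType) (V : lmodType R) (W : submodule V) :=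
  [SubChoice_isSubLmodule of submod W by <:].

Notation zquot W := (Quotient.quot (GRing.ZmodClosed.clone _ (smem W) _)).

Definition quotmod (R : pzRingType) (V : lmodType R) (W : submodule V) : Type :=
  zquot W.

Section QuotMod.
Variables (R : pzRingType) (V : lmodType R) (W : submodule V).

HB.instance Definition _ := GRing.Zmodule.on (quotmod W).

Definition qpi (x : V) : quotmod W := (\pi_(zquot W) x)%qT.

Lemma qpi_is_zmod_morphism : zmod_morphism qpi.
Proof. exact: (raddfB (\pi_(zquot W)%qT)). Qed.
HB.instance Definition _ :=
  GRing.isZmodMorphism.Build V (quotmod W) qpi qpi_is_zmod_morphism.

Definition qrepr (x : quotmod W) : V := repr (x : zquot W).

Lemma qreprK : cancel qrepr qpi.
Proof. exact: reprK. Qed.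

Lemma qpiP x y : qpi x = qpi y <-> W (x - y).
Proof.
split=> [/eqP|Wxy]; first by rewrite -Quotient.idealrBE => /smemP.
by apply/eqP; rewrite -Quotient.idealrBE; apply/smemP.
Qed.

Definition qscale (a : R) (x : quotmod W) : quotmod W := qpi (a *: qrepr x).

Lemma qscaleE a x : qscale a (qpi x) = qpi (a *: x).
Proof.
apply/qpiP; rewrite -scalerBr; apply: submoduleZ.
by apply/qpiP; rewrite qreprK.
Qed.

Lemma qscaleA a b x : qscale a (qscale b x) = qscale (a * b) x.
Proof. by rewrite -[x]qreprK !qscaleE scalerA. Qed.
Lemma qscale1 : left_id 1 qscale.
Proof. by move=> x; rewrite -[x]qreprK !qscaleE scale1r. Qed.
Lemma qscaleDr : right_distributive qscale +%R.
Proof.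
move=> a x y; rewrite -[x]qreprK -[y]qreprK -raddfD !qscaleE -raddfD.
by rewrite scalerDr.
Qed.
Lemma qscaleDl x : {morph qscale^~ x : a b / a + b}.
Proof. by move=> a b; rewrite -[x]qreprK !qscaleE -raddfD scalerDl. Qed.

HB.instance Definition _ := GRing.Zmodule_isLmodule.Build R (quotmod W)
  qscaleA qscale1 qscaleDr qscaleDl.

Lemma qpi_is_scalable : scalable qpi.
Proof. by move=> a x; rewrite -qscaleE. Qed.
HB.instance Definition _ :=
  GRing.isScalable.Build R V (quotmod W) *:%R qpi qpi_is_scalable.

Section Lift.
Variables (P : lmodType R) (f : {linear V -> P}).
Hypothesis f0 : forall x, W x -> f x = 0.

Definition qlift of (forall x, W x -> f x = 0) := fun x : quotmod W => f (qrepr x).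

Lemma qliftE x : qlift f0 (qpi x) = f x.
Proof.
apply/eqP; rewrite -subr_eq0 -raddfB; apply/eqP/f0.
by apply/qpiP; rewrite qreprK.
Qed.

Lemma qlift_is_linear : linear (qlift f0).
Proof.
move=> a x y; rewrite -[x]qreprK -[y]qreprK -linearZ -raddfD !qliftE.
exact: linearP.
Qed.
HB.instance Definition _ := GRing.isLinear.Build R (quotmod W) P *:%R
  (qlift f0) qlift_is_linear.
End Lift.

End QuotMod.

Section Span.
Variables (R : pzRingType) (V : lmodType R) (S : set V).

Definition in_span : set V :=
  [set x | forall W : submodule V, S `<=` W -> W x].

Lemma in_span0 : in_span 0.
Proof. by move=> W _; exact: submodule0. Qed.
Lemma in_spanD x y : in_span x -> in_span y -> in_span (x + y).
Proof. by move=> hx hy W SW; apply: submoduleD; [exact: hx|exact: hy]. Qed.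
Lemma in_spanZ a x : in_span x -> in_span (a *: x).
Proof. by move=> hx W SW; apply: submoduleZ; exact: hx. Qed.

Definition span : submodule V := Submodule in_span0 in_spanD in_spanZ.

Lemma sub_span : S `<=` span.
Proof. by move=> x Sx W; apply. Qed.
End Span.

Section KernelImage.
Variables (R : pzRingType) (V W : lmodType R) (f : {linear V -> W}).

Lemma ker0 : [set x | f x = 0] 0.
Proof. exact: raddf0. Qed.
Lemma kerD x y :
  [set x | f x = 0] x -> [set x | f x = 0] y -> [set x | f x = 0] (x + y).
Proof. by move=> /= fx fy; rewrite raddfD /= fx fy addr0. Qed.
Lemma kerZ a x : [set x | f x = 0] x -> [set x | f x = 0] (a *: x).
Proof. by move=> /= fx; rewrite linearZ_LR fx scaler0. Qed.

Definition ker : submodule V := Submodule ker0 kerD kerZ.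
End KernelImage.

Section Homology.
Variables (R : pzRingType) (U V W : lmodType R).
Variables (f : {linear U -> V}) (g : {linear V -> W}).

Definition in_bound : set (submod (ker g)) := [set x | exists u, f u = val x].

Lemma in_bound0 : in_bound 0.
Proof. by exists 0; rewrite !raddf0. Qed.
Lemma in_boundD x y : in_bound x -> in_bound y -> in_bound (x + y).
Proof. by move=> [u fu] [v fv]; exists (u + v); rewrite !raddfD /= fu fv. Qed.
Lemma in_boundZ a x : in_bound x -> in_bound (a *: x).
Proof. by move=> [u fu]; exists (a *: u); rewrite !linearZ /= fu. Qed.

Definition bound : submodule (submod (ker g)) :=
  Submodule in_bound0 in_boundD in_boundZ.

(* [ker g / im f]; it is the homology at [V] when [g \o f] vanishes. *)
Definition homology : Type := quotmod bound.
HB.instance Definition _ := GRing.Lmodule.on homology.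
End Homology.

Section Free.
Variables (R : pzRingType) (K : choiceType).

Definition fin_support : set (K -> R^o) :=
  [set x | finite_set [set k | x k != 0]].

Lemma fin_support0 : fin_support 0.
Proof.
rewrite /fin_support /= (_ : [set k | _] = set0) //.
by apply/seteqP; split=> // k /=; rewrite eqxx.
Qed.
Lemma fin_supportD x y : fin_support x -> fin_support y -> fin_support (x + y).
Proof.
move=> fx fy; apply: (@sub_finite_set _ _ ([set k | x k != 0] `|` [set k | y k != 0])).
  move=> k /= xyk; have [xk|] := eqVneq (x k) 0; last by left.
  by right; apply: contra_neq xyk => yk; rewrite addrfctE xk yk addr0.
by rewrite finite_setU.
Qed.
Lemma fin_supportZ a x : fin_support x -> fin_support (a *: x).
Proof.
apply: sub_finite_set => k /=; apply: contra_neq => xk.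
by rewrite scalrfctE xk scaler0.
Qed.

Definition fin_support_submodule : submodule (K -> R^o) :=
  Submodule fin_support0 fin_supportD fin_supportZ.

Definition free : Type := submod fin_support_submodule.
HB.instance Definition _ := GRing.Lmodule.on free.

Definition fcoef (x : free) : K -> R := val x.

Lemma fcoef_fin x : finite_set [set k | fcoef x k != 0].
Proof. exact: (asboolP _ (valP x)). Qed.

Lemma single_fin (k : K) : smem fin_support_submodule (fun l => (l == k)%:R : R^o).
Proof.
apply/asboolP; apply: (@sub_finite_set _ _ [set k]); last exact: finite_set1.
by move=> l /=; case: (eqVneq l k) => //= _; rewrite ?eqxx.
Qed.

Definition single (k : K) : free := Sub _ (single_fin k).

Section Lift.
Variables (P : lmodType R) (f : K -> P).

Definition flift (x : free) : P := \sum_(k \in [set: K]) fcoef x k *: f k.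

Lemma fliftE x (A : {fset K}) : (forall k, k \notin A -> fcoef x k = 0) ->
  flift x = \sum_(k <- A) fcoef x k *: f k.
Proof. by move=> xA; apply: fsbigTE => k /xA ->; rewrite scale0r. Qed.

Lemma flift_is_linear : linear flift.
Proof.
move=> a x y.
pose A := fset_set ([set k | fcoef x k != 0] `|` [set k | fcoef y k != 0]).
have inA k : k \notin A -> fcoef x k = 0 /\ fcoef y k = 0.
  rewrite in_fset_set ?finite_setU; last by split; exact: fcoef_fin.
  rewrite notin_setE /= => /not_orP[] /negP; rewrite negbK => /eqP ->.
  by move=> /negP; rewrite negbK => /eqP ->.
rewrite !(fliftE (A := A)); last 3 first.
- by move=> k /inA[].
- by move=> k /inA[].
- move=> k /inA[xk yk]; change (a * fcoef x k + fcoef y k = 0).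
  by rewrite xk yk mulr0 addr0.
rewrite scaler_sumr -big_split /=; apply: eq_bigr => k _.
by rewrite scalerA -scalerDl.
Qed.
HB.instance Definition _ :=
  GRing.isLinear.Build R free P *:%R flift flift_is_linear.

Lemma flift_single k : flift (single k) = f k.
Proof.
rewrite (fliftE (A := [fset k]%fset)); last first.
  by move=> l; rewrite inE /fcoef /= => /negbTE ->.
by rewrite big_seq_fset1 /fcoef /= eqxx scale1r.
Qed.
End Lift.

Lemma free_eq (P : lmodType R) (f g : {linear free -> P}) :
  (forall k, f (single k) = g (single k)) -> f =1 g.
Proof.
move=> fg x.
have -> : x = \sum_(k <- fset_set [set k | fcoef x k != 0]) fcoef x k *: single k.
  apply: val_inj; apply/funext => l.
  rewrite raddf_sum fct_sumE /=.
  have [xl|xl] := eqVneq (fcoef x l) 0.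
    rewrite (_ : sval x l = 0) // big1 // => k _.
    rewrite scalrfctE /=; case: (eqVneq l k) => [<-|_].
      by rewrite xl scale0r.
    by rewrite scaler0.
  rewrite (bigD1_seq l) ?fset_uniq //=; last first.
    by rewrite in_fset_set; [rewrite inE|exact: fcoef_fin].
  rewrite scalrfctE /= eqxx big1 ?addr0; last first.
    move=> k kl; rewrite scalrfctE /= eq_sym (negbTE kl).
    by rewrite scaler0.
  by rewrite /GRing.scale /= mulr1.
by rewrite !linear_sum; apply: eq_bigr => k _; rewrite !linearZ fg.
Qed.

End Free.

Section Tensor.
Variable R : comPzRingType.

Section Def.
Variables A N : lmodType R.

Notation "[ a , n ]" := (single R (a : A, n : N)).

Definition tens_rel : set (free R (A * N)%type) := [set x |
  [\/ exists a a' n, x = [a + a', n] - [a, n] - [a', n],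
      exists a n n', x = [a, n + n'] - [a, n] - [a, n'],
      exists r a n, x = [r *: a, n] - r *: [a, n] |
      exists r a n, x = [a, r *: n] - r *: [a, n]]].

Definition tens : Type := quotmod (span tens_rel).
HB.instance Definition _ := GRing.Lmodule.on tens.

Definition tmul (a : A) (n : N) : tens := qpi (span tens_rel) [a, n].

Lemma tmulDl a a' n : tmul (a + a') n = tmul a n + tmul a' n.
Proof.
rewrite /tmul -raddfD; apply/qpiP; apply: sub_span.
by apply: Or41; exists a, a', n; rewrite opprD addrA.
Qed.
Lemma tmulDr a n n' : tmul a (n + n') = tmul a n + tmul a n'.
Proof.
rewrite /tmul -raddfD; apply/qpiP; apply: sub_span.
by apply: Or42; exists a, n, n'; rewrite opprD addrA.
Qed.
Lemma tmulZl r a n : tmul (r *: a) n = r *: tmul a n.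
Proof.
rewrite /tmul -linearZ; apply/qpiP; apply: sub_span.
by apply: Or43; exists r, a, n.
Qed.
Lemma tmulZr r a n : tmul a (r *: n) = r *: tmul a n.
Proof.
rewrite /tmul -linearZ; apply/qpiP; apply: sub_span.
by apply: Or44; exists r, a, n.
Qed.

Lemma tens_eq (P : lmodType R) (f g : {linear tens -> P}) :
  (forall a n, f (tmul a n) = g (tmul a n)) -> f =1 g.
Proof.
move=> fg x; rewrite -[x]qreprK.
by apply: (@free_eq R _ P (f \o qpi _) (g \o qpi _)) => -[a n]; exact: fg.
Qed.

Record bilinear_map (P : lmodType R) := BilinearMap {
  bfun :> A -> N -> P;
  bfunDl : forall a a' n, bfun (a + a') n = bfun a n + bfun a' n;
  bfunDr : forall a n n', bfun a (n + n') = bfun a n + bfun a n';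
  bfunZl : forall r a n, bfun (r *: a) n = r *: bfun a n;
  bfunZr : forall r a n, bfun a (r *: n) = r *: bfun a n }.

Section Lift.
Variables (P : lmodType R) (b : bilinear_map P).

Lemma tlift_subproof x : span tens_rel x -> flift (fun k => b k.1 k.2) x = 0.
Proof.
move=> /(_ (ker (flift (fun k => b k.1 k.2)))); apply.
move=> {x} _ [] [u [v [w ->]]] /=;
  rewrite ?raddfB /= ?linearZ /= !flift_single /=.
- by rewrite bfunDl -addrA -opprD subrr.
- by rewrite bfunDr -addrA -opprD subrr.
- by rewrite bfunZl scalerN subrr.
- by rewrite bfunZr scalerN subrr.
Qed.

Definition tlift : tens -> P := qlift tlift_subproof.
HB.instance Definition _ := GRing.Linear.on tlift.

Lemma tliftE a n : tlift (tmul a n) = b a n.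
Proof. exact: etrans (qliftE _ _) (flift_single _ _). Qed.
End Lift.
End Def.

Section TMap.
Variables (A A' N N' : lmodType R) (f : {linear A -> A'}) (g : {linear N -> N'}).

Lemma tmap_Dl a a' n :
  tmul (f (a + a')) (g n) = tmul (f a) (g n) + tmul (f a') (g n).
Proof. by rewrite raddfD tmulDl. Qed.
Lemma tmap_Dr a n n' :
  tmul (f a) (g (n + n')) = tmul (f a) (g n) + tmul (f a) (g n').
Proof. by rewrite raddfD tmulDr. Qed.
Lemma tmap_Zl r a n : tmul (f (r *: a)) (g n) = r *: tmul (f a) (g n).
Proof. by rewrite linearZ tmulZl. Qed.
Lemma tmap_Zr r a n : tmul (f a) (g (r *: n)) = r *: tmul (f a) (g n).
Proof. by rewrite linearZ tmulZr. Qed.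

Definition tmap : tens A N -> tens A' N' :=
  tlift (BilinearMap tmap_Dl tmap_Dr tmap_Zl tmap_Zr).
HB.instance Definition _ := GRing.Linear.on tmap.

Lemma tmapE a n : tmap (tmul a n) = tmul (f a) (g n).
Proof. exact: tliftE. Qed.
End TMap.

End Tensor.
Arguments tlift : simpl never.
Arguments tmap : simpl never.

Definition restr (R S : pzRingType) (i : {rmorphism R -> S}) (P : lmodType S) :
  Type := P.

Section Restr.
Variables (R S : pzRingType) (i : {rmorphism R -> S}) (P : lmodType S).

HB.instance Definition _ := GRing.Zmodule.on (restr i P).

Definition restr_scale (r : R) (x : restr i P) : restr i P := i r *: (x : P).

Lemma restr_scaleA a b x :
  restr_scale a (restr_scale b x) = restr_scale (a * b) x.
Proof. by rewrite /restr_scale scalerA rmorphM. Qed.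
Lemma restr_scale1 : left_id 1 restr_scale.
Proof. by move=> x; rewrite /restr_scale rmorph1 scale1r. Qed.
Lemma restr_scaleDr : right_distributive restr_scale +%R.
Proof. by move=> a x y; exact: scalerDr. Qed.
Lemma restr_scaleDl x : {morph restr_scale^~ x : a b / a + b}.
Proof. by move=> a b; rewrite /restr_scale rmorphD scalerDl. Qed.

HB.instance Definition _ := GRing.Zmodule_isLmodule.Build R (restr i P)
  restr_scaleA restr_scale1 restr_scaleDr restr_scaleDl.
End Restr.

(* [ext_type i N] is the tensor product of the [R]-modules [S] and [N]; the
   [S]-module structure comes from multiplication on the left factor. *)
Definition ext_type (R S : comPzRingType) (i : {rmorphism R -> S})
    (N : lmodType R) : Type :=
  tens (restr i S^o) N.

Section Ext.
Variables (R S : comPzRingType) (i : {rmorphism R -> S}).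

Definition smul (s : S) (x : restr i S^o) : restr i S^o := s * (x : S).

Lemma smulA a b x : smul a (smul b x) = smul (a * b) x.
Proof. exact: mulrA. Qed.
Lemma smul1 x : smul 1 x = x.
Proof. exact: mul1r. Qed.
Lemma smulDl a b x : smul (a + b) x = smul a x + smul b x.
Proof. exact: mulrDl. Qed.

Lemma smul_is_linear s : linear (smul s).
Proof.
move=> r x y; change (s * (i r * (x : S) + (y : S)) = i r * (s * (x : S)) + s * (y : S)).
by rewrite mulrDr mulrCA.
Qed.
HB.instance Definition _ s := GRing.isLinear.Build R (restr i S^o) (restr i S^o)
  *:%R (smul s) (smul_is_linear s).

Section Module.
Variable N : lmodType R.

HB.instance Definition _ := GRing.Zmodule.on (ext_type i N).

Definition ext_scale (s : S) (x : ext_type i N) : ext_type i N :=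
  tmap (smul s) (idfun : {linear N -> N}) x.

Lemma ext_scaleA a b x : ext_scale a (ext_scale b x) = ext_scale (a * b) x.
Proof.
apply: (@tens_eq _ _ _ _ (tmap (smul a) idfun \o tmap (smul b) idfun)) => s n.
by rewrite /= !tmapE /= smulA.
Qed.
Lemma ext_scale1 : left_id 1 ext_scale.
Proof.
apply: (@tens_eq _ _ _ _ (tmap (smul 1) idfun) idfun) => s n.
by rewrite /= tmapE /= smul1.
Qed.
Lemma ext_scaleDr : right_distributive ext_scale +%R.
Proof. by move=> a x y; exact: raddfD. Qed.
Lemma ext_scaleDl x : {morph ext_scale^~ x : a b / a + b}.
Proof.
move=> a b; apply: (@tens_eq _ _ _ _ (tmap (smul (a + b)) idfun)
  (tmap (smul a) idfun \+ tmap (smul b) idfun)) => s n.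
by rewrite /= !tmapE -tmulDl /= smulDl.
Qed.

HB.instance Definition _ := GRing.Zmodule_isLmodule.Build S (ext_type i N)
  ext_scaleA ext_scale1 ext_scaleDr ext_scaleDl.

Definition ext : lmodType S := ext_type i N.
End Module.

Section Map.
Variables (N N' : lmodType R) (g : {linear N -> N'}).

Definition ext_fun (x : ext_type i N) : ext_type i N' := tmap idfun g x.

Lemma ext_fun_is_linear : linear ext_fun.
Proof.
move=> s x y; rewrite /ext_fun raddfD; congr (_ + _).
apply: (@tens_eq _ _ _ _ (tmap idfun g \o tmap (smul s) idfun)
  (tmap (smul s) idfun \o tmap idfun g)) => t n.
by rewrite /= !tmapE.
Qed.
HB.instance Definition _ := GRing.isLinear.Build S (ext_type i N) (ext_type i N')
  *:%R ext_fun ext_fun_is_linear.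

Definition ext_map : {linear ext N -> ext N'} := ext_fun.
End Map.
End Ext.
Arguments ext_map [R S] i [N N'] g.
Arguments ext_map : simpl never.

Definition exact (R : pzRingType) (U V W : lmodType R)
    (f : {linear U -> V}) (g : {linear V -> W}) : Prop :=
  forall v, g v = 0 <-> exists u, f u = v.

Section Resolution.
Variable R : pzRingType.

Definition cover (M : lmodType R) : lmodType R := free R M.

Definition aug (M : lmodType R) : {linear cover M -> M} := flift (@idfun M).

Definition syz (M : lmodType R) : lmodType R := submod (ker (aug M)).

Definition syz_incl (M : lmodType R) : {linear syz M -> cover M} :=
  (val : submod (ker (aug M)) -> cover M).

Definition syz_diff (M : lmodType R) : {linear cover (syz M) -> cover M} :=
  syz_incl M \o aug (syz M).

(* The [R]-module [M] is covered by the free module on its underlying set;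
   iterating on kernels gives a free resolution of [M], see [res_exact0] and
   [res_exact]. *)
Definition res (M : lmodType R) (k : nat) : lmodType R := cover (iter k syz M).

Definition diff (M : lmodType R) (k : nat) : {linear res M k.+1 -> res M k} :=
  syz_diff (iter k syz M).

Lemma aug_surj M x : exists y, aug M y = x.
Proof. by exists (single R x); exact: flift_single. Qed.

Lemma syz_incl_inj M : injective (syz_incl M).
Proof. exact: val_inj. Qed.

Lemma syz_incl_exact M : exact (syz_incl M) (aug M).
Proof.
move=> v; split=> [v0|[[u u0] <-]]; last exact: (asboolP _ u0).
have hv : smem (ker (aug M)) v by apply/asboolP.
by exists (Sub v hv : submod _); exact: SubK.
Qed.

Lemma syz_diff_exact0 M : exact (syz_diff M) (aug M).
Proof.
move=> v; split=> [/syz_incl_exact[u <-]|[u <-]].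
  by have [w <-] := aug_surj u; exists w.
by apply/syz_incl_exact; exists (aug (syz M) u).
Qed.

Lemma syz_diff_exact M : exact (syz_diff (syz M)) (syz_diff M).
Proof.
move=> v; rewrite -[X in X <-> _]/(syz_incl M (aug (syz M) v) = 0).
rewrite -(raddf0 (syz_incl M)); apply: iff_trans (syz_diff_exact0 v).
by split=> [/syz_incl_inj|->].
Qed.

Lemma res_exact0 M : exact (diff M 0) (aug M).
Proof. exact: syz_diff_exact0. Qed.

Lemma res_exact M k : exact (diff M k.+1) (diff M k).
Proof. exact: (@syz_diff_exact (iter k syz M)). Qed.

End Resolution.
Arguments aug [R] M.

(* [H_j] of the complex [S (x)_R res M], an [S]-module; in degree [0] the
   outgoing differential is zero. *)
Definition Tor (R S : comPzRingType) (i : {rmorphism R -> S}) (j : nat)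
    (M : lmodType R) : lmodType S :=
  match j with
  | 0 => homology (ext_map i (diff M 0))
                  (\0 : {linear ext i (res M 0) -> ext i (res M 0)})
  | k.+1 => homology (ext_map i (diff M k.+1)) (ext_map i (diff M k))
  end.

Definition fg_free (R : pzRingType) (F : lmodType R) : Prop :=
  exists (d : nat) (f : {linear 'rV[R]_d -> F}), bijective f.

(* There is an exact sequence [F k -> ... -> F 0 -> M -> 0]; the terms of index
   larger than [k] are unconstrained, and exactness at [F k] is not required. *)
Definition presented (R : pzRingType) (k : nat) (M : lmodType R) : Prop :=
  exists (F : nat -> lmodType R) (e : {linear F 0 -> M})
         (p : forall l, {linear F l.+1 -> F l}),
    [/\ forall l, (l <= k)%N -> fg_free (F l),
        forall x, exists y, e y = x,
        (0 < k)%N -> exact (p 0) e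
      & forall l, (l.+1 < k)%N -> exact (p l.+1) (p l)].

Definition presented_in (R : pzRingType) (X : lmodType R -> Prop) (k : nat)
    (M : lmodType R) : Prop :=
  X M /\ presented k M.

Definition coherent (R : pzRingType) (n : nat) (X : lmodType R -> Prop) : Prop :=
  forall M, presented_in X n M -> presented_in X n.+1 M.

Definition property_star (R : pzRingType) (X : lmodType R -> Prop) : Prop :=
  forall M, presented_in X 1 M ->
  exists (k : nat) (K : lmodType R)
         (f : {linear K -> 'rV[R]_k}) (g : {linear 'rV[R]_k -> M}),
    [/\ injective f, exact f g, forall x, exists y, g y = x & X K].

(* [(i1, i2)] identifies [R] with [{(a, b) | j1 a = j2 b}]. *)
Definition is_pullback (R R1 R2 R0 : pzRingType)
    (i1 : {rmorphism R -> R1}) (i2 : {rmorphism R -> R2})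
    (j1 : {rmorphism R1 -> R0}) (j2 : {rmorphism R2 -> R0}) : Prop :=
  injective (fun r => (i1 r, i2 r)) /\
  range (fun r => (i1 r, i2 r)) = [set ab | j1 ab.1 = j2 ab.2].

(* Main.v *)
(* Since M is n-presented, it has finite free F_m with syzygies K_m for m <= n.
   As Tor_{m+1}(R_i, M) is the kernel of R_i (x) K_{m+1} -> R_i (x) F_m,
   induction on m shows that R_i (x) K_m is (n+1-m)-presented for m <= n+1,
   starting from the coherence of R_i applied to R_i (x) M.  So K = K_{n+1} has
   finitely generated base changes, and it remains to see that K is finitely
   generated.  Choose a finitely generated W in K generating both R_i (x) K.
   The kernel I of R -> R_1 is an ideal of R_2, so for a in I multiplication by
   a on K factors through R_2 (x) K, which gives I K in W; as R_1 = R / I, it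
   follows that K = W.

   Tor is computed from the resolution by the huge free modules on underlying
   sets; its syzygies are compared with the K_m up to maps factoring through
   projectives, which the kernels above do not see. *)
From HB Require Import structures.
From mathcomp Require Import all_boot all_order all_algebra.
From mathcomp Require Import boolp classical_sets.
Require Import Defs.

Set Implicit Arguments.
Unset Strict Implicit.
Unset Printing Implicit Defensive.

Import GRing.Theory.
Local Open Scope ring_scope.

(** * Finite presentation *)

Definition surj (A B : Type) (f : A -> B) := forall y, exists x, f x = y.

Lemma inj_surj_bijective (A B : Type) (f : A -> B) :
  injective f -> surj f -> bijective f.
Proof.
move=> fi /choice[g gK]; exists g => // x; exact: fi.
Qed.

Section Modules.
Variable R : pzRingType.
Implicit Types U V W A B C F G M K : lmodType R.

Lemma linear_ofP U V (f : U -> V) :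
  linear f -> exists g : {linear U -> V}, g =1 f.
Proof.
move=> lf.
by exists (HB.pack_for {linear U -> V} f (GRing.isLinear.Build R U V *:%R f lf)).
Qed.

Definition projective F := forall B C (g : {linear B -> C}) (h : {linear F -> C}),
  surj g -> exists h' : {linear F -> B}, forall x, g (h' x) = h x.

Definition short_exact A B C (f : {linear A -> B}) (g : {linear B -> C}) :=
  [/\ injective f, exact f g & surj g].

(** Preimages under an injective map are unique, so choosing them is automatically linear. *)
Lemma factor_inj U V W (f : {linear U -> V}) (h : {linear W -> V}) :
  injective f -> (forall x, exists y, f y = h x) ->
  exists h' : {linear W -> U}, forall x, f (h' x) = h x.
Proof.
move=> finj /choice[h' hE].
have [|g gE] := @linear_ofP _ _ h'; last by exists g => x; rewrite gE.
by move=> a x y; apply: finj; rewrite linearP !hE linearP.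
Qed.

Lemma val_kerP U V (f : {linear U -> V}) x :
  f x = 0 <-> exists y : submod (ker f), val y = x.
Proof.
split=> [f0|[[y y0] <-]]; last exact: (asboolP _ y0).
have h : smem (ker f) x by apply/asboolP.
by exists (Sub x h : submod _); exact: SubK.
Qed.

Lemma ker_short_exact U V (f : {linear U -> V}) :
  surj f -> short_exact (val : {linear submod (ker f) -> U}) f.
Proof. by split=> //; [exact: val_inj | exact: val_kerP]. Qed.

Lemma short_exact0 A B C (f : {linear A -> B}) (g : {linear B -> C}) x :
  short_exact f g -> g (f x) = 0.
Proof. by case=> _ fg _; apply/fg; exists x. Qed.

Lemma linear_bij_inv U V (f : {linear U -> V}) : bijective f ->
  exists g : {linear V -> U}, cancel f g /\ cancel g f.
Proof.
case=> g fK gK.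
have [|g' g'E] := @linear_ofP _ _ g.
  by move=> a x y; apply: (can_inj fK); rewrite linearP !gK.
by exists g'; split=> x; rewrite g'E.
Qed.

Lemma rV_lift d V (b : 'I_d -> V) :
  exists g : {linear 'rV[R]_d -> V}, forall x, g x = \sum_j x 0 j *: b j.
Proof.
apply: linear_ofP => a x y; rewrite scaler_sumr -big_split /=.
by apply: eq_bigr => j _; rewrite !mxE scalerDl scalerA.
Qed.

Lemma rV_linearE d V (g : {linear 'rV[R]_d -> V}) x :
  g x = \sum_j x 0 j *: g (delta_mx 0 j).
Proof.
by rewrite {1}(row_sum_delta x) linear_sum; apply: eq_bigr => j _; rewrite linearZ.
Qed.

Lemma fg_free_projective F : fg_free F -> projective F.
Proof.
move=> [d [f /linear_bij_inv[f' [fK f'K]]]] B C g h gsurj.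
have [b bE] := choice gsurj.
have [k kE] := @rV_lift d B (fun j => b (h (f (delta_mx 0 j)))).
exists (k \o f') => x /=; rewrite kE linear_sum -[in RHS](f'K x).
rewrite -[RHS]/((h \o f) (f' x)) [RHS]rV_linearE /=.
by apply: eq_bigr => j _; rewrite linearZ bE.
Qed.

Lemma free_projective (T : choiceType) : projective (free R T).
Proof.
move=> B C g h gsurj; have [b bE] := choice gsurj.
exists (flift (fun k => b (h (single R k)))).
apply: (@free_eq R T C (g \o _) h) => k /=.
by rewrite flift_single bE.
Qed.

Lemma fg_free_pair F G : fg_free F -> fg_free G -> fg_free (F * G)%type.
Proof.
move=> [d [f /linear_bij_inv[f' [fK f'K]]]] [d' [g /linear_bij_inv[g' [gK g'K]]]].
have [|h hE] := @linear_ofP 'rV[R]_(d + d') (F * G)%type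
  (fun x => (f (lsubmx x), g (rsubmx x))).
  by move=> a x y; rewrite !linearP.
exists (d + d')%N, h; exists (fun p => row_mx (f' p.1) (g' p.2)) => x; rewrite !hE.
  by rewrite /= fK gK hsubmxK.
by rewrite row_mxKl row_mxKr f'K g'K; case: x.
Qed.

(** * Finite presentation along short exact sequences *)

Lemma presented0P M :
  presented 0 M <-> exists F (e : {linear F -> M}), fg_free F /\ surj e.
Proof.
split=> [[F [e [_ [Ff es _ _]]]]|[F [e [Ff es]]]].
  by exists (F 0%N), e; split=> //; exact: Ff.
by exists (fun=> F), e, (fun=> \0).
Qed.

(** Splitting off the first free module makes a resolution recursive in [k], the form on which later
    inductions run. The kernel of [F 0 -> M] is resolved by the shifted sequence; conversely two
    sequences are spliced. *)
Lemma presentedSP k M : presented k.+1 M <->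
  exists F K (f : {linear K -> F}) (e : {linear F -> M}),
    [/\ fg_free F, short_exact f e & presented k K].
Proof.
split=> [[F [e [p [Ff es ex0 ex]]]]|[F [K [f [e [Ff [finj fe es] [G [e' [p [Gf e's ex0 ex]]]]]]]]]].
  exists (F 0%N), (submod (ker e)), val, e.
  split; [exact: Ff | exact: ker_short_exact|].
  have [|q qE] := @factor_inj _ _ _ (val : {linear submod (ker e) -> F 0%N}) (p 0%N) val_inj.
    by move=> x; apply/val_kerP; apply/ex0 => //; exists x.
  exists (fun l => F l.+1), q, (fun l => p l.+1); split.
  - by move=> l lk; exact: Ff.
  - move=> x; have /ex0[//|y yE] : e (val x) = 0 by apply/val_kerP; exists x.
    by exists y; apply: val_inj; rewrite qE.
  - move=> k0 v; rewrite -(ex 0%N k0 v) -qE.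
    by split=> [->|v0] //; apply: val_inj; rewrite v0.
  - by move=> l lk; exact: (ex l.+1).
pose F' l := if l is l'.+1 then G l' else F.
pose p' l : {linear F' l.+1 -> F' l} :=
  match l return {linear F' l.+1 -> F' l} with
  | 0 => f \o e' | l'.+1 => p l' end.
exists F', e, p'; split=> //.
- by case=> [|l] lk //; exact: Gf.
- move=> _ v; rewrite (fe v); split=> [[u <-]|[u <-]]; last by exists (e' u).
  by have [w <-] := e's u; exists w.
- case=> [|l] lk; last exact: ex.
  move=> v /=; rewrite -(ex0 lk v).
  by split=> [|->]; rewrite ?raddf0 // -(raddf0 f) => /finj.
Qed.

Lemma presented_iso k M M' (f : {linear M -> M'}) :
  bijective f -> presented k M -> presented k M'.
Proof.
move=> [g fK gK]; have finj := can_inj fK.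
have fs U (e : {linear U -> M}) : surj e -> surj (f \o e).
  by move=> es y; have [x xE] := es (g y); exists x; rewrite /= xE gK.
case: k => [/presented0P[F [e [Ff es]]]|k /presentedSP[F [K [h [e [Ff [hi he es] Kk]]]]]].
  by apply/presented0P; exists F, (f \o e); split=> //; exact: fs.
apply/presentedSP; exists F, K, h, (f \o e); split=> //; split=> //; last exact: fs.
by move=> v; rewrite -(he v) /=; split=> [|->]; rewrite ?raddf0 // -(raddf0 f) => /finj.
Qed.

(** Horseshoe argument: free covers [F] of [A] and [G] of [C] combine to one of [B], the map from
    [G] being lifted through [g], and the kernels form a short exact sequence to which induction
    applies. *)
Lemma presented_extension k A B C (f : {linear A -> B}) (g : {linear B -> C}) :
  short_exact f g -> presented k A -> presented k C -> presented k B.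
Proof.
have horse A' B' C' (f' : {linear A' -> B'}) (g' : {linear B' -> C'}) F G
    (a : {linear F -> A'}) (c : {linear G -> C'}) :
    short_exact f' g' -> fg_free G -> surj a -> surj c ->
    exists s : {linear G -> B'}, exists b : {linear (F * G)%type -> B'},
    [/\ forall x, g' (s x) = c x, forall x, b x = f' (a x.1) + s x.2 & surj b].
  move=> fg /fg_free_projective Gp asurj csurj.
  have [_ fg' gs] := fg.
  have [s sE] := Gp _ _ g' c gs.
  have [|b bE] := @linear_ofP (F * G)%type B' (fun x => f' (a x.1) + s x.2).
    by move=> r x y /=; rewrite !linearP scalerDr addrACA.
  exists s, b; split=> // y; have [z zE] := csurj (g' y).
  have /fg'[u uE] : g' (y - s z) = 0 by rewrite raddfB /= sE zE subrr.
  by have [x xE] := asurj u; exists (x, z); rewrite bE /= xE uE subrK.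
elim: k A B C f g => [|k IH] A B C f g fg.
  move=> /presented0P[F [a [Ff asurj]]] /presented0P[G [c [Gf csurj]]].
  have [s [b [_ _ bs]]] := horse _ _ _ _ _ _ _ _ _ fg Gf asurj csurj.
  by apply/presented0P; exists (F * G)%type, b; split=> //; exact: fg_free_pair.
move=> /presentedSP[F [KA [ka [a [Ff aex KAk]]]]].
move=> /presentedSP[G [KC [kc [c [Gf cex KCk]]]]].
have [ai aE asurj] := aex; have [ci cE csurj] := cex.
have [s [b [sE bE bs]]] := horse _ _ _ _ _ _ _ _ _ fg Gf asurj csurj.
have [fi fgE gs] := fg.
apply/presentedSP; exists (F * G)%type, (submod (ker b)), val, b.
split; [exact: fg_free_pair | exact: ker_short_exact|].
have [|i0 i0E] := @linear_ofP KA (F * G)%type (fun x => (ka x, 0)).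
  by move=> r x y; rewrite linearP; congr (_, _); rewrite /= scaler0 addr0.
have [|i iE] := @factor_inj _ _ _ (val : {linear submod (ker b) -> _}) i0 val_inj.
  by move=> x; apply/val_kerP; rewrite bE i0E /= (short_exact0 _ aex) !raddf0 addr0.
have bker (x : submod (ker b)) : f (a (val x).1) + s (val x).2 = 0.
  by rewrite -bE; apply/val_kerP; exists x.
have [|q qE] := @factor_inj _ _ _ kc (snd \o (val : {linear submod (ker b) -> _})) ci.
  move=> x /=; apply/cE; rewrite -sE.
  by have /(congr1 g) := bker x; rewrite raddfD /= (short_exact0 _ fg) raddf0 add0r.
apply: (IH _ _ _ i q) => //; split.
- move=> x y /(congr1 val); rewrite !iE !i0E => -[]; exact: ai.
- move=> v; split=> [q0|[u <-]].
    have v2 : (val v).2 = 0 by rewrite -[LHS]qE q0 raddf0.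
    have := bker v; rewrite v2 raddf0 addr0 -(raddf0 f) => /fi /aE[u uE].
    exists u; apply: val_inj; rewrite iE i0E uE -v2.
    by case: (val v).
  by apply: ci; rewrite qE -[LHS]/((val (i u)).2) iE i0E raddf0.
(* The lift [s (kc z)] need not vanish, but it lies in the image of [A], so a suitable first
   component cancels it. *)
- move=> z; have /fgE[y yE] : g (s (kc z)) = 0.
    by rewrite sE (short_exact0 _ cex).
  have [x xE] := asurj (- y).
  have /val_kerP[w wE] : b (x, kc z) = 0.
    by rewrite bE /= xE raddfN /= yE addNr.
  by exists w; apply: ci; rewrite qE -[LHS]/((val w).2) wE.
Qed.

Lemma fg_free_presented k F : fg_free F -> presented k F.
Proof.
move=> Ff; have z0 : fg_free 'rV[R]_0 by exists 0%N, idfun; exists id.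
elim: k F Ff => [|k IH] F Ff.
  by apply/presented0P; exists F, idfun; split=> // x; exists x.
apply/presentedSP; exists F, 'rV[R]_0, \0, idfun; split=> //; last exact: IH.
split=> [x y _|v|y]; first by apply/rowP; case.
- by split=> [v0|[u <-]] //; exists 0; exact: esym v0.
- by exists y.
Qed.

(** The kernel of [F -> B -> C] is an extension of [A] by the kernel of [F -> B]. *)
Lemma presented_quotient k A B C (f : {linear A -> B}) (g : {linear B -> C}) :
  short_exact f g -> presented k A -> presented k.+1 B -> presented k.+1 C.
Proof.
move=> [fi fgE gs] Ak /presentedSP[F [K [h [e [Ff hex Kk]]]]].
have [hi he es] := hex.
have ges : surj (g \o e).
  by move=> z; have [y <-] := gs z; have [x <-] := es y; exists x.
apply/presentedSP; exists F, (submod (ker (g \o e))), val, (g \o e).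
split=> //; first exact: ker_short_exact.
have [|i iE] := @factor_inj _ _ _ (val : {linear submod (ker (g \o e)) -> _}) h val_inj.
  by move=> x; apply/val_kerP; rewrite /= (short_exact0 _ hex) raddf0.
have [|q qE] := @factor_inj _ _ _ f (e \o (val : {linear submod (ker (g \o e)) -> _})) fi.
  by move=> x; apply/fgE; apply/(val_kerP (g \o e)); exists x.
apply: (presented_extension (f := i) (g := q)) => //; split.
- by move=> x y /(congr1 val); rewrite !iE => /hi.
- move=> v; split=> [q0|[u <-]].
    have /he[u uE] : e (val v) = 0 by rewrite -[LHS]qE q0 raddf0.
    by exists u; apply: val_inj; rewrite iE.
  by apply: fi; rewrite qE -[LHS]/(e (val (i u))) iE raddf0 (short_exact0 _ hex).
- move=> y; have [x xE] := es (f y).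
  have /val_kerP[w wE] : (g \o e) x = 0 by rewrite /= xE; apply/fgE; exists y.
  by exists w; apply: fi; rewrite qE -[LHS]/(e (val w)) wE.
Qed.

Lemma presented0_quotient B C (g : {linear B -> C}) :
  surj g -> presented 0 B -> presented 0 C.
Proof.
move=> gs /presented0P[F [e [Ff es]]]; apply/presented0P; exists F, (g \o e).
by split=> // z; have [y <-] := gs z; have [x <-] := es y; exists x.
Qed.

(* Schanuel: with lifts [phi : F -> G] and [psi : G -> F] over [M], the sequence
   [0 -> G -> B * F -> A -> 0] is exact, where [A] and [B] are the kernels of
   [F -> M] and [G -> M]. *)
Lemma presented_syzygy k M F A (f : {linear A -> F}) (e : {linear F -> M}) :
  presented k.+1 M -> fg_free F -> short_exact f e -> presented k A.
Proof.
move=> /presentedSP[G [B [g [c [Gf cex Bk]]]]] Ff eex.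
have [fi fE es] := eex; have [gi gE cs] := cex.
have [phi phiE] := fg_free_projective Ff e cs.
have [psi psiE] := fg_free_projective Gf c es.
pose pB : {linear (B * F)%type -> B} := fst.
pose pF : {linear (B * F)%type -> F} := snd.
(* Both [psi (g b)] and [x - psi (phi x)] vanish in [M], so the map lands in the kernel [A] of
   [e]. *)
pose q0 : {linear (B * F)%type -> F} :=
  (psi \o g \o pB) \+ (pF \- (psi \o phi \o pF)).
have q0E x : q0 x = psi (g x.1) + (x.2 - psi (phi x.2)) by [].
have [|q qE] := @factor_inj _ _ _ f q0 fi.
  move=> x; apply/fE; rewrite q0E raddfD raddfB /= !psiE phiE.
  by rewrite (short_exact0 _ cex) subrr addr0.
have qs : surj q.
  move=> a; have /gE[b bE] : c (phi (f a)) = 0 by rewrite phiE (short_exact0 _ eex).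
  by exists (b, f a); apply: fi; rewrite qE q0E /= bE addrC subrK.
have BFk : presented k (B * F)%type.
  have [|i iE] := @linear_ofP B (B * F)%type (fun x => (x, 0)).
    by move=> r x y; congr (_, _); rewrite /= scaler0 addr0.
  apply: (presented_extension (f := i) (g := snd)) => //; last exact: fg_free_presented.
  split=> [x y|v|y]; first by rewrite !iE => -[].
  - split=> [v0|[u <-]]; last by rewrite iE.
    by exists v.1; rewrite iE -v0; case: (v).
  - by exists (0, y).
case: k => [|k] in Bk BFk *; first exact: presented0_quotient qs BFk.
have [|d dE] := @factor_inj _ _ _ g (phi \o psi \- idfun : {linear G -> G}) gi.
  by move=> x; apply/gE; rewrite raddfB /= phiE psiE subrr.
(* The kernel of [q] is a copy of [G], with [d] the defect of [phi \o psi] from the identity, which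
   lands in [B]. *)
have [|i iE] := @linear_ofP G (B * F)%type (fun x => (d x, psi x)).
  by move=> r x y; rewrite !linearP.
apply: (presented_quotient (f := i) (g := q)) BFk => //.
  split=> // [x y|v].
    rewrite !iE => -[/(congr1 g)]; rewrite !dE /= => + E.
    by rewrite E => /addrI/oppr_inj.
  rewrite (_ : q v = 0 <-> q0 v = 0); last first.
    by rewrite -qE; split=> [->|]; rewrite ?raddf0 // -(raddf0 f) => /fi.
  split=> [|[u <-]]; rewrite q0E ?iE /=.
    (* Solving [v = (d u, psi u)] for [u]: as [g (d u) = phi (psi u) - u], the only candidate is
       [phi v.2 - g v.1]. *)
    move=> v0; exists (phi v.2 - g v.1); rewrite iE.
    have E : psi (phi v.2 - g v.1) = v.2.
      by rewrite raddfB; apply/eqP; rewrite -subr_eq0 -oppr_eq0 !opprB addrCA v0.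
    rewrite E; have -> : d (phi v.2 - g v.1) = v.1.
      by apply: gi; rewrite dE /= E opprB addrC subrK.
    by case: (v).
  by rewrite dE /= raddfB addrA subrK subrr.
exact: fg_free_presented.
Qed.

Lemma image_subproof U V (f : {linear U -> V}) :
  [/\ exists u, f u = 0,
      forall x y, (exists u, f u = x) -> (exists u, f u = y) -> exists u, f u = x + y
    & forall a x, (exists u, f u = x) -> exists u, f u = a *: x].
Proof.
split; first by exists 0; exact: raddf0.
- by move=> _ _ [u <-] [v <-]; exists (u + v); exact: raddfD.
- by move=> a _ [u <-]; exists (a *: u); exact: linearZ.
Qed.

Definition image U V (f : {linear U -> V}) : submodule V :=
  let: And3 f0 fD fZ := image_subproof f in
  @Submodule R V (fun x => exists u, f u = x) f0 fD fZ.

Lemma imageP U V (f : {linear U -> V}) x :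
  image f x <-> exists u, f u = x.
Proof. by rewrite /image; case: image_subproof. Qed.

End Modules.

(** * Stable equivalence and syzygies *)

Section StableEquivalence.
Variable R : pzRingType.
Implicit Types F C K Z P : lmodType R.

Definition projective_factor K Z (f : K -> Z) :=
  exists P (p : {linear K -> P}) (q : {linear P -> Z}),
    projective P /\ forall x, f x = q (p x).

(** Isomorphism in the stable category, where maps factoring through projectives are zero. *)
Definition stably_equivalent K Z :=
  exists (a : {linear K -> Z}) (b : {linear Z -> K}),
    projective_factor (fun x => b (a x) - x) /\
    projective_factor (fun z => a (b z) - z).

Lemma stably_equivalent_refl K : stably_equivalent K K.
Proof.
have z0 : projective_factor (fun x : K => x - x).
  exists 'rV[R]_0, \0, \0; split; last by move=> x; rewrite subrr raddf0.
  by apply: fg_free_projective; exists 0%N, idfun; exists id.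
by exists idfun, idfun.
Qed.

Lemma syzygy_lift K' F K Z' C Z (f : {linear K' -> F}) (e : {linear F -> K})
    (f' : {linear Z' -> C}) (e' : {linear C -> Z}) (a : {linear K -> Z}) :
  projective F -> short_exact f e -> short_exact f' e' ->
  exists (aF : {linear F -> C}) (a' : {linear K' -> Z'}),
    (forall x, e' (aF x) = a (e x)) /\ (forall x, f' (a' x) = aF (f x)).
Proof.
move=> Fp fex [f'i f'E e's].
have [aF aFE] := Fp _ _ e' (a \o e) e's.
have [|a' a'E] := @factor_inj _ _ _ _ f' (aF \o f) f'i; last by exists aF, a'.
by move=> x; apply/f'E; rewrite /= aFE /= (short_exact0 _ fex) raddf0.
Qed.

(** If [c - 1 = q p] through a projective, lift [q] to [r] into [F]. Then [cF - 1 - r p e] lands in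
    [K'], and on [K'] the term [r p e] vanishes. *)
Lemma syzygy_homotopy K' F K (f : {linear K' -> F}) (e : {linear F -> K})
    (c : {linear K -> K}) (cF : {linear F -> F}) (c' : {linear K' -> K'}) :
  short_exact f e -> (forall x, e (cF x) = c (e x)) ->
  (forall x, f (c' x) = cF (f x)) -> projective_factor (fun x => c x - x) ->
  exists h : {linear F -> K'}, forall x, c' x - x = h (f x).
Proof.
move=> fex cFE c'E [P [p [q [Pp pqE]]]].
have [fi fE es] := fex.
have [r rE] := Pp _ _ e q es.
pose t : {linear F -> F} := (cF \- idfun) \- (r \o p \o e).
have tE x : t x = cF x - x - r (p (e x)) by [].
have [|h hE] := @factor_inj _ _ _ _ f t fi.
  by move=> x; apply/fE; rewrite tE !raddfB /= rE -pqE cFE subrr.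
exists h => x; apply: fi; rewrite hE tE raddfB /= c'E.
by rewrite (short_exact0 _ fex) (raddf0 p) (raddf0 r) subr0.
Qed.

(** The factorization through [f] and [f'] is kept explicit: it survives base change and makes the
    homotopies vanish on the kernels of the base-changed inclusions. *)
Lemma syzygy_stable K' F K Z' C Z (f : {linear K' -> F}) (e : {linear F -> K})
    (f' : {linear Z' -> C}) (e' : {linear C -> Z}) :
  projective F -> projective C -> short_exact f e -> short_exact f' e' ->
  stably_equivalent K Z ->
  exists (aF : {linear F -> C}) (a' : {linear K' -> Z'})
         (bF : {linear C -> F}) (b' : {linear Z' -> K'})
         (h : {linear F -> K'}) (h' : {linear C -> Z'}),
    [/\ forall x, f' (a' x) = aF (f x), forall z, f (b' z) = bF (f' z),
        forall x, b' (a' x) - x = h (f x) & forall z, a' (b' z) - z = h' (f' z)].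
Proof.
move=> Fp Cp fex f'ex [a [b [ba ab]]].
have [aF [a' [aFE a'E]]] := syzygy_lift a Fp fex f'ex.
have [bF [b' [bFE b'E]]] := syzygy_lift b Cp f'ex fex.
have [|||h hE] := @syzygy_homotopy _ _ _ f e (b \o a) (bF \o aF) (b' \o a') fex.
- by move=> x; rewrite /= bFE aFE.
- by move=> x; rewrite /= b'E a'E.
- exact: ba.
have [|||h' h'E] := @syzygy_homotopy _ _ _ f' e' (a \o b) (aF \o bF) (a' \o b') f'ex.
- by move=> x; rewrite /= aFE bFE.
- by move=> x; rewrite /= a'E b'E.
- exact: ab.
by exists aF, a', bF, b', h, h'.
Qed.

Lemma stably_equivalent_syzygy K' F K Z' C Z
    (f : {linear K' -> F}) (e : {linear F -> K})
    (f' : {linear Z' -> C}) (e' : {linear C -> Z}) :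
  projective F -> projective C -> short_exact f e -> short_exact f' e' ->
  stably_equivalent K Z -> stably_equivalent K' Z'.
Proof.
move=> Fp Cp fex f'ex KZ.
have [aF [a' [bF [b' [h [h' [_ _ hE h'E]]]]]]] := syzygy_stable Fp Cp fex f'ex KZ.
by exists a', b'; split; [exists F, f, h | exists C, f', h'].
Qed.

End StableEquivalence.

(** Here [g1] is the cokernel of [f], so dividing the kernel of [g] by the image of [f] amounts to
    applying [g1]. *)
Lemma homology_ker (S : pzRingType) (U V W' W : lmodType S) (f : {linear U -> V})
    (g : {linear V -> W}) (g1 : {linear V -> W'}) (g2 : {linear W' -> W}) :
  surj g1 -> exact f g1 -> (forall x, g x = g2 (g1 x)) ->
  exists h : {linear homology f g -> submod (ker g2)}, bijective h.
Proof.
move=> g1s fg1 gE.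
have [|h hE] := @factor_inj _ _ _ _ (val : {linear submod (ker g2) -> W'})
    (g1 \o (val : {linear submod (ker g) -> V})) val_inj.
  by move=> x; apply/val_kerP; rewrite -gE; apply/val_kerP; exists x.
have h0 x : bound f g x -> h x = 0.
  by move=> [u ux]; apply: val_inj; rewrite hE raddf0; apply/fg1; exists u.
exists (qlift h0); apply: inj_surj_bijective => [x y|y].
  rewrite -[_ x]/(h (qrepr x)) -[_ y]/(h (qrepr y)) => /(congr1 val).
  rewrite !hE => E; rewrite -[x](@qreprK S) -[y](@qreprK S); apply/qpiP.
  have /fg1[u uE] : g1 (val (qrepr x) - val (qrepr y)) = 0.
    by rewrite raddfB; apply/eqP; rewrite subr_eq0; apply/eqP; exact: E.
  by exists u; rewrite uE raddfB.
have [v vE] := g1s (val y).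
have /val_kerP[w wE] : g v = 0 by rewrite gE vE; apply/val_kerP; exists y.
exists (qpi _ w); apply: val_inj; rewrite -[_ (qpi _ w)]/(qlift h0 (qpi _ w)) qliftE.
by rewrite hE -[LHS]/(g1 (val w)) wE vE.
Qed.

(** * Right exactness of the tensor product *)

Section TensorExact.
Variable R : comPzRingType.

Lemma tens_sum (A N : lmodType R) (t : tens A N) :
  exists s : seq (A * N), t = \sum_(p <- s) tmul p.1 p.2.
Proof.
pose P (t : tens A N) := exists s : seq (A * N), t = \sum_(p <- s) tmul p.1 p.2.
have P0 : P 0 by exists [::]; rewrite big_nil.
have PD x y : P x -> P y -> P (x + y).
  by move=> [s ->] [s' ->]; exists (s ++ s'); rewrite big_cat.
have PZ a x : P x -> P (a *: x).
  move=> [s ->]; exists [seq (a *: p.1, p.2) | p <- s].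
  by rewrite big_map scaler_sumr; apply: eq_bigr => p _; rewrite tmulZl.
pose W := Submodule P0 PD PZ.
(* The sums of pure tensors form a submodule [W]; the projection modulo [W] kills every pure tensor,
   hence is zero. *)
suff /(_ t) : qpi W =1 (\0 : {linear tens A N -> quotmod W}).
  by rewrite /= -(raddf0 (qpi W)) => /qpiP; rewrite subr0.
apply: tens_eq => a n /=; rewrite -(raddf0 (qpi W)); apply/qpiP.
by rewrite subr0; exists [:: (a, n)]; rewrite big_seq1.
Qed.

Lemma tmulBr (A N : lmodType R) (a : A) (n n' : N) :
  tmul a (n - n') = tmul a n - tmul a n'.
Proof. by rewrite -scaleN1r tmulDr tmulZr scaleN1r. Qed.

Lemma tmap_surj (A N N' : lmodType R) (e : {linear N -> N'}) :
  surj e -> surj (tmap (idfun : {linear A -> A}) e).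
Proof.
move=> /choice[l lK] t; have [s ->] := tens_sum t.
exists (\sum_(p <- s) tmul p.1 (l p.2)); rewrite linear_sum.
by apply: eq_bigr => p _ /=; rewrite tmapE /= lK.
Qed.

(** Modulo the image of [tens A K], the tensor [tmul a x] depends on [x] only through [e x].
    Choosing preimages [l] thus gives a map [beta] on [tens A M] with [beta \o te] the projection,
    so whatever [te] kills is in the image. *)
Lemma tmap_exact (A K F M : lmodType R) (f : {linear K -> F}) (e : {linear F -> M}) :
  exact f e -> surj e ->
  exact (tmap idfun f : {linear tens A K -> tens A F})
    (tmap idfun e : {linear tens A F -> tens A M}).
Proof.
move=> fe es; have [l lK] := choice es.
pose tf : {linear tens A K -> tens A F} := tmap idfun f.
pose te : {linear tens A F -> tens A M} := tmap idfun e.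
rewrite -/tf -/te; pose W := image tf.
have WE a x y : e x = e y -> qpi W (tmul a x) = qpi W (tmul a y).
  move=> exy; apply/qpiP/imageP; rewrite -tmulBr.
  have /fe[u <-] : e (x - y) = 0 by rewrite raddfB /= exy subrr.
  by exists (tmul a u); rewrite /tf /= tmapE.
pose b a m := qpi W (tmul a (l m)).
have bDl a a' m : b (a + a') m = b a m + b a' m by rewrite /b tmulDl raddfD.
have bDr a m m' : b a (m + m') = b a m + b a m'.
  by rewrite /b -raddfD -tmulDr; apply: WE; rewrite raddfD /= !lK.
have bZl r a m : b (r *: a) m = r *: b a m by rewrite /b tmulZl linearZ.
have bZr r a m : b a (r *: m) = r *: b a m.
  by rewrite /b -linearZ -tmulZr; apply: WE; rewrite linearZ /= !lK.
pose beta : {linear tens A M -> quotmod W} :=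
  tlift (BilinearMap bDl bDr bZl bZr).
have betaE : beta \o te =1 qpi W.
  by apply: tens_eq => a n; rewrite /te /beta /= tmapE tliftE; apply: WE; rewrite lK.
move=> v; split=> [v0|[u <-]].
  have := betaE v; rewrite -[LHS]/(beta (te v)) v0 (raddf0 beta).
  rewrite -(raddf0 (qpi W)) => /esym/qpiP/imageP.
  by rewrite subr0.
suff /(_ u) : te \o tf =1 (\0 : {linear tens A K -> tens A M}) by [].
apply: tens_eq => a n; rewrite /te /tf /= !tmapE /=.
have -> : e (f n) = 0 by apply/fe; exists n.
by rewrite -(scale0r (0 : M)) tmulZr scale0r.
Qed.

End TensorExact.

(** * Base change *)

Section BaseChange.
Variables (R S : comPzRingType) (i : {rmorphism R -> S}).
Implicit Types F K M N Z C : lmodType R.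

Definition pure N (s : S) (n : N) : ext i N := tmul (s : restr i S^o) n.

Lemma pureZ N s t (n : N) : s *: pure t n = pure (s * t) n.
Proof. exact: tmapE. Qed.

Lemma pureZr N (r : R) (n : N) : pure 1 (r *: n) = i r *: pure 1 n.
Proof.
rewrite pureZ mulr1; apply: etrans (tmulZr r (1 : restr i S^o) n) _.
rewrite -tmulZl; congr (tmul _ _).
by rewrite -[LHS]/(i r * 1) mulr1.
Qed.

Lemma pure_sum N (I : Type) (r : seq I) (f : I -> N) s :
  pure s (\sum_(k <- r) f k) = \sum_(k <- r) pure s (f k).
Proof.
apply: (big_morph (pure s) (fun x y => tmulDr _ x y)).
apply: (addrI (pure s (0 : N))).
by apply: etrans (esym (tmulDr _ _ _)) _; rewrite !addr0.
Qed.

Lemma ext_sum N (t : ext i N) :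
  exists s : seq (S * N), t = \sum_(p <- s) pure p.1 p.2.
Proof. exact: (@tens_sum R (restr i S^o) N t). Qed.

Lemma ext_map_surj M N (e : {linear M -> N}) : surj e -> surj (ext_map i e).
Proof. exact: tmap_surj. Qed.

Lemma ext_map_exact K F M (f : {linear K -> F}) (e : {linear F -> M}) :
  exact f e -> surj e -> exact (ext_map i f) (ext_map i e).
Proof. exact: (@tmap_exact R (restr i S^o)). Qed.

Lemma ext_map_comp K F M (f : {linear K -> F}) (e : {linear F -> M})
    (h : {linear K -> M}) :
  (forall x, e (f x) = h x) ->
  forall t, ext_map i e (ext_map i f t) = ext_map i h t.
Proof.
move=> efE; apply: (@tens_eq R (restr i S^o) K _ (tmap idfun e \o tmap idfun f)
  (tmap idfun h)) => s n.
by rewrite /= !tmapE efE.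
Qed.

Lemma ext_map_square K F M K' (f : {linear K -> F}) (e : {linear F -> M})
    (f' : {linear K -> K'}) (e' : {linear K' -> M}) :
  (forall x, e (f x) = e' (f' x)) ->
  forall t, ext_map i e (ext_map i f t) = ext_map i e' (ext_map i f' t).
Proof.
move=> efE t; rewrite (@ext_map_comp _ _ _ _ _ (e' \o f') efE).
by apply/esym/ext_map_comp.
Qed.

Lemma ext_map_homotopy K F M (a : {linear K -> M}) (b : {linear M -> K})
    (f : {linear K -> F}) (h : {linear F -> K}) :
  (forall x, b (a x) - x = h (f x)) ->
  forall t, ext_map i b (ext_map i a t) - t = ext_map i h (ext_map i f t).
Proof.
move=> hE; apply: (@tens_eq R (restr i S^o) K _
  ((tmap idfun b \o tmap idfun a) \- idfun) (tmap idfun h \o tmap idfun f)) => s n.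
by rewrite /= !tmapE -hE tmulBr.
Qed.

Lemma ext_linear_eq N (P : lmodType S) (f g : {linear ext i N -> P}) :
  (forall n, f (pure 1 n) = g (pure 1 n)) -> f =1 g.
Proof.
move=> fg t; have [s ->] := ext_sum t; rewrite !linear_sum.
apply: eq_bigr => p _ /=.
by rewrite -[p.1]mulr1 -pureZ !linearZ /= fg.
Qed.

(** Universal property of extension of scalars; semilinearity along [i] is spelled out because [h]
    joins modules over different rings. *)
Lemma ext_lift N (P : lmodType S) (h : N -> P) :
  (forall a x y, h (a *: x + y) = i a *: h x + h y) ->
  exists f : {linear ext i N -> P}, forall s n, f (pure s n) = s *: h n.
Proof.
move=> hlin; have hD x y : h (x + y) = h x + h y.
  by have := hlin 1 x y; rewrite rmorph1 !scale1r.
have h0 : h 0 = 0 by apply: (addrI (h 0)); rewrite -hD !addr0.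
have hZ a x : h (a *: x) = i a *: h x by have := hlin a x 0; rewrite h0 !addr0.
pose b (s : restr i S^o) (x : N) : restr i P := (s : S) *: h x.
have bDl s t x : b (s + t) x = b s x + b t x by exact: (@scalerDl S P).
have bDr s x y : b s (x + y) = b s x + b s y.
  by rewrite /b hD; exact: (@scalerDr S P).
have bZl (r : R) s x : b (r *: s) x = r *: b s x.
  by apply/esym; exact: (@scalerA S P).
have bZr (r : R) s x : b s (r *: x) = r *: b s x.
  rewrite /b hZ -[RHS]/(i r *: (s *: h x)).
  by rewrite !(@scalerA S P) mulrC.
pose f : ext i N -> P := tlift (BilinearMap bDl bDr bZl bZr).
have fE s n : f (pure s n) = s *: h n by exact: (tliftE (BilinearMap bDl bDr bZl bZr) s n).
have fD x y : f (x + y) = f x + f y.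
  exact: (raddfD (tlift (BilinearMap bDl bDr bZl bZr))).
have f0 : f 0 = 0 by apply: (addrI (f 0)); rewrite -fD !addr0.
have [|f' f'E] := @linear_ofP S (ext i N) P f; last first.
  by exists f' => s n; rewrite f'E fE.
(* [tlift] gives only [R]-linearity; compatibility with scalars of [S] is checked on sums of pure
   tensors. *)
move=> a x y; rewrite fD; congr (_ + _); have [s ->] := ext_sum x.
rewrite scaler_sumr !(big_morph f fD f0) scaler_sumr.
by apply: eq_bigr => p _; rewrite pureZ !fE scalerA.
Qed.

(** A basis of [F] stays one after base change: [phi] sends the standard basis to its pure tensors
    and [psi] reads coordinates through [i]. *)
Lemma fg_free_ext F : fg_free F -> fg_free (ext i F).
Proof.
move=> [d [f /linear_bij_inv[g [fK gK]]]].
have [phi phiE] := @rV_lift S d (ext i F) (fun j => pure 1 (f (delta_mx 0 j))).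
have [|psi psiE] := @ext_lift F 'rV[S]_d (fun x => map_mx i (g x)).
  by move=> a x y; rewrite linearP map_mxD map_mxZ.
have phi_delta j : phi (delta_mx 0 j) = pure 1 (f (delta_mx 0 j)).
  rewrite phiE (bigD1 j) //= big1 => [|k kj].
    by rewrite mxE !eqxx scale1r addr0.
  by rewrite mxE eqxx (negbTE kj) scale0r.
exists d, phi, psi => [x|].
  rewrite -[LHS]/((psi \o phi) x) [LHS]rV_linearE [RHS]row_sum_delta.
  apply: eq_bigr => j _; congr (_ *: _); rewrite /= phi_delta psiE fK scale1r.
  by apply/matrixP => k l; rewrite !mxE; case: (_ && _); rewrite ?rmorph1 ?rmorph0.
apply: (ext_linear_eq (f := phi \o psi) (g := idfun)) => x /=.
rewrite psiE scale1r rV_linearE -[in RHS](gK x) {2}(row_sum_delta (g x)).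
rewrite linear_sum pure_sum; apply: eq_bigr => j _.
by rewrite phi_delta mxE linearZ pureZr.
Qed.

End BaseChange.

(** * Tor and descent along the pullback *)

Lemma syz_short_exact (R : pzRingType) (M : lmodType R) :
  short_exact (syz_incl M) (aug M).
Proof.
by split; [exact: syz_incl_inj | exact: syz_incl_exact | exact: aug_surj].
Qed.

(** With [Z] the [k]-th syzygy, the differential out of degree [k.+1] passes through [syz Z], and by
    right exactness [ext i (syz Z)] is the cokernel of the incoming one. *)
Lemma Tor_syzygy (R S : comPzRingType) (i : {rmorphism R -> S}) k (M : lmodType R) :
  exists h : {linear Tor i k.+1 M ->
      submod (ker (ext_map i (syz_incl (iter k (@syz R) M))))}, bijective h.
Proof.
set Z := iter k _ M.
apply: (@homology_ker S _ _ _ _ (ext_map i (syz_diff (syz Z)))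
  (ext_map i (syz_diff Z)) (ext_map i (aug (syz Z)))).
- exact/ext_map_surj/aug_surj.
- by apply: ext_map_exact; [exact: syz_diff_exact0 | exact: aug_surj].
- move=> t; apply: esym.
  exact: (@ext_map_comp R S i _ _ _ (aug (syz Z)) (syz_incl Z) (syz_diff Z) (fun=> erefl)).
Qed.

Lemma submodule_sum (R : pzRingType) (V : lmodType R) (W : submodule V)
    (I : eqType) (r : seq I) (f : I -> V) :
  (forall k, k \in r -> W (f k)) -> W (\sum_(k <- r) f k).
Proof.
move=> fW; rewrite big_seq; apply: big_ind => //; first exact: submodule0.
exact: submoduleD.
Qed.

Lemma presented0_generated (R : pzRingType) (M : lmodType R) :
  presented 0 M <->
  exists s : seq M, forall W : submodule M, (forall x, x \in s -> W x) ->
    forall x, W x.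
Proof.
split=> [/presented0P[F [e [[d [f [g fK gK]]] es]]]|[s sM]].
  exists [seq e (f (delta_mx 0 j)) | j : 'I_d] => W sW y.
  have [x <-] := es y; rewrite -[x]gK -[e _]/((e \o f) (g x)) rV_linearE.
  by apply: submodule_sum => j _; apply/submoduleZ/sW/map_f; rewrite mem_enum.
have [e eE] := @rV_lift R (size s) M (fun j => s`_j).
apply/presented0P; exists 'rV[R]_(size s), e.
split=> [|y]; first by exists (size s), idfun; exists id.
apply/imageP; apply: sM => x /(nthP 0)[k ks <-]; apply/imageP.
exists (delta_mx 0 (Ordinal ks)); rewrite eE (bigD1 (Ordinal ks)) //= big1 => [|j jk].
  by rewrite mxE !eqxx scale1r addr0.
by rewrite mxE eqxx (negbTE jk) scale0r.
Qed.

(** Each generator of [ext i N] is a sum of pure tensors; [s] collects their second entries. Lists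
    with second entries in [W] avoid the possibly non-injective map from [ext i W]. *)
Lemma ext_generated (R S : comPzRingType) (i : {rmorphism R -> S})
    (N : lmodType R) :
  presented 0 (ext i N) ->
  exists s : seq N, forall W : submodule N, (forall x, x \in s -> W x) ->
    forall t : ext i N, exists l : seq (S * N),
      (forall p, p \in l -> W p.2) /\ t = \sum_(p <- l) pure i p.1 p.2.
Proof.
move=> /presented0_generated[G GN]; have [d dE] := choice (@ext_sum R S i N).
exists (flatten [seq map snd (d g) | g <- G]) => W sW.
pose P (t : ext i N) := exists l : seq (S * N),
  (forall p, p \in l -> W p.2) /\ t = \sum_(p <- l) pure i p.1 p.2.
have P0 : P 0 by exists [::]; rewrite big_nil.
have PD x y : P x -> P y -> P (x + y).
  move=> [l [lW ->]] [l' [l'W ->]]; exists (l ++ l'); rewrite big_cat.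
  by split=> // p; rewrite mem_cat => /orP[/lW|/l'W].
have PZ a x : P x -> P (a *: x).
  move=> [l [lW ->]]; exists [seq (a * p.1, p.2) | p <- l]; split.
    move=> q /mapP[p pl ->]. exact (lW p pl).
  by rewrite big_map scaler_sumr; apply: eq_bigr => p _; rewrite pureZ.
apply: (GN (Submodule P0 PD PZ)) => g gG; exists (d g); split; last exact: dE.
move=> p pd; apply: sW; apply/flattenP; exists (map snd (d g)).
  exact: (map_f (fun g => map snd (d g)) gG).
exact: (map_f snd pd).
Qed.

(** * Descent of finite generation *)

Section Descent.
Variables (R R1 R2 R0 : comPzRingType).
Variables (i1 : {rmorphism R -> R1}) (i2 : {rmorphism R -> R2}).
Variables (j1 : {rmorphism R1 -> R0}) (j2 : {rmorphism R2 -> R0}).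
Hypothesis pb : is_pullback i1 i2 j1 j2.
Hypothesis i1s : surj i1.

Lemma pullback_inj a b : i1 a = i1 b -> i2 a = i2 b -> a = b.
Proof. by move=> e1 e2; apply: pb.1; rewrite e1 e2. Qed.

(* [ker i1] is the ideal [ker j2] of [R2]: multiplying [a] by scalars of [R2]
   stays in [R]. *)
Lemma conductor a : i1 a = 0 ->
  exists c : R2 -> R, forall s, i1 (c s) = 0 /\ i2 (c s) = i2 a * s.
Proof.
move=> a0.
suff /choice[c cE] : forall s : R2, exists r, i1 r = 0 /\ i2 r = i2 a * s by exists c.
move=> s.
have : [set ab : R1 * R2 | j1 ab.1 = j2 ab.2]%classic (0, i2 a * s).
  have : [set ab : R1 * R2 | j1 ab.1 = j2 ab.2]%classic (i1 a, i2 a).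
    by rewrite -pb.2; exists a.
  by rewrite /= a0 rmorphM raddf0 => <-; rewrite mul0r.
by rewrite -pb.2 => -[r _ [r1 r2]]; exists r.
Qed.

(** Let [W] contain the second entries collected over both rings. First [W] absorbs the multiples of
    [N] by the kernel of [i1], through [R2]; then [N] modulo [W] is a module over [R1], and
    expanding [pure i1 1 x] shows that [x] is zero there. *)
Lemma generated_descent (N : lmodType R) :
  presented 0 (ext i1 N) -> presented 0 (ext i2 N) -> presented 0 N.
Proof.
move=> /ext_generated[s1 s1P] /ext_generated[s2 s2P].
apply/presented0_generated; exists (s1 ++ s2) => W sW x.
have {}s1P := s1P W; have {}s2P := s2P W.
have W1 y : y \in s1 -> W y by move=> ys; apply: sW; rewrite mem_cat ys.
have W2 y : y \in s2 -> W y by move=> ys; apply: sW; rewrite mem_cat ys orbT.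
have aW a (y : N) : i1 a = 0 -> W (a *: y).
  move=> a0; have [c cE] := conductor a0.
  (* An element of [R] is determined by its images in [R1] and [R2]; this makes [c] additive and
     [R]-linear. *)
  have cP s r : i1 r = 0 -> i2 r = i2 a * s -> c s = r.
    by move=> r1 r2; have [c1 c2] := cE s; apply: pullback_inj; rewrite ?c1 ?c2.
  pose b (s : restr i2 R2^o) (z : N) := c s *: z.
  have bDl s t z : b (s + t) z = b s z + b t z.
    rewrite /b -scalerDl; congr (_ *: _); have [s1' s2'] := cE s.
    have [t1 t2] := cE t; apply: cP; first by rewrite rmorphD /= s1' t1 addr0.
    by rewrite rmorphD /= s2' t2; apply/esym; exact: mulrDr.
  have bDr s z z' : b s (z + z') = b s z + b s z' by exact: scalerDr.
  have bZl (r : R) s z : b (r *: s) z = r *: b s z.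
    rewrite /b scalerA; congr (_ *: _); have [s1' s2'] := cE s.
    apply: cP; first by rewrite rmorphM /= s1' mulr0.
    by rewrite rmorphM /= s2' mulrCA.
  have bZr (r : R) s z : b s (r *: z) = r *: b s z.
    by rewrite /b !scalerA mulrC.
  pose phi : {linear tens (restr i2 R2^o) N -> N} :=
    tlift (BilinearMap bDl bDr bZl bZr).
  have phiE s z : phi (pure i2 s z) = c s *: z by exact: tliftE.
  (* [phi] sends this tensor to [a *: y], while its expansion with second entries in [W] puts the
     value in [W]. *)
  have [l [lW lE]] := s2P W2 (pure i2 1 y).
  have c1 : c 1 = a by apply: cP; rewrite // mulr1.
  rewrite -c1 -phiE lE.
  rewrite [X in W X](big_morph phi (raddfD phi) (raddf0 phi)).
  by apply: submodule_sum => p pl; rewrite phiE; apply: submoduleZ; exact: lW.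
(* The section [r] of [i1] need not be a ring morphism, but its defects lie in the kernel of [i1],
   hence act as zero modulo [W]. *)
have [r rE] := choice i1s.
have piE a b (y : N) : i1 a = i1 b -> qpi W (a *: y) = qpi W (b *: y).
  by move=> ab; apply/qpiP; rewrite -scalerBl; apply: aW; rewrite rmorphB /= ab subrr.
pose b (s : restr i1 R1^o) (z : N) := qpi W (r s *: z).
have bDl s t z : b (s + t) z = b s z + b t z.
  by rewrite /b -raddfD -scalerDl; apply: piE; rewrite rmorphD /= !rE.
have bDr s z z' : b s (z + z') = b s z + b s z'.
  by rewrite /b scalerDr; exact: raddfD.
have bZl (a : R) s z : b (a *: s) z = a *: b s z.
  by rewrite /b -linearZ /= scalerA; apply: piE; rewrite rmorphM /= !rE.
have bZr (a : R) s z : b s (a *: z) = a *: b s z.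
  by rewrite /b scalerA mulrC -scalerA; exact: linearZ.
pose phi : {linear tens (restr i1 R1^o) N -> quotmod W} :=
  tlift (BilinearMap bDl bDr bZl bZr).
have phiE s z : phi (pure i1 s z) = qpi W (r s *: z) by exact: tliftE.
have [l [lW lE]] := s1P W1 (pure i1 1 x).
rewrite -[x]subr0; apply/qpiP; rewrite raddf0 -[x]scale1r.
rewrite -(piE (r 1)) -?phiE ?rE ?rmorph1 // lE.
rewrite [LHS](big_morph phi (raddfD phi) (raddf0 phi)) big_seq big1 // => p pl.
by rewrite phiE -(raddf0 (qpi W)); apply/qpiP; rewrite subr0; exact/submoduleZ/lW.
Qed.

End Descent.

(** [ext i K'] is an extension of the kernel of [ext i F -> ext i K] by that of
    [ext i K' -> ext i F]. The first is a syzygy of [ext i K]; the second agrees with the kernel for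
    [Z] by stable equivalence. *)
Lemma presented_ext_syzygy (R S : comPzRingType) (i : {rmorphism R -> S}) k
    (K' F K Z : lmodType R) (f : {linear K' -> F}) (e : {linear F -> K}) :
  fg_free F -> short_exact f e -> stably_equivalent K Z ->
  presented k.+1 (ext i K) ->
  presented k (submod (ker (ext_map i (syz_incl Z)))) ->
  presented k (ext i K').
Proof.
move=> Ff fex KZ Kk Zk; have [fi fE es] := fex.
have [aF [a' [bF [b' [h [h' [aE bE hE h'E]]]]]]] :=
  syzygy_stable (fg_free_projective Ff) (@free_projective R Z) fex (syz_short_exact Z) KZ.
set f' := syz_incl Z in Zk aE bE h'E.
have [|A AE] := @factor_inj _ _ _ _ (val : {linear submod (ker (ext_map i f')) -> _})
    (ext_map i a' \o (val : {linear submod (ker (ext_map i f)) -> _})) val_inj.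
  move=> t; apply/val_kerP; rewrite [LHS](ext_map_square aE).
  have -> : ext_map i f (val t) = 0 by apply/val_kerP; exists t.
  exact: raddf0.
have [|B BE] := @factor_inj _ _ _ _ (val : {linear submod (ker (ext_map i f)) -> _})
    (ext_map i b' \o (val : {linear submod (ker (ext_map i f')) -> _})) val_inj.
  move=> t; apply/val_kerP; rewrite [LHS](ext_map_square bE).
  have -> : ext_map i f' (val t) = 0 by apply/val_kerP; exists t.
  exact: raddf0.
(* The homotopy passes through [ext_map i f], which is zero on its own kernel, so the restricted
   maps cancel. *)
have BA : cancel A B.
  move=> t; apply: val_inj; apply/eqP; rewrite -subr_eq0; apply/eqP.
  rewrite BE -[X in X - _]/(ext_map i b' (val (A t))) AE.
  rewrite [LHS](ext_map_homotopy hE).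
  have -> : ext_map i f (val t) = 0 by apply/val_kerP; exists t.
  exact: raddf0.
have AB : cancel B A.
  move=> t; apply: val_inj; apply/eqP; rewrite -subr_eq0; apply/eqP.
  rewrite AE -[X in X - _]/(ext_map i a' (val (B t))) BE.
  rewrite [LHS](ext_map_homotopy h'E).
  have -> : ext_map i f' (val t) = 0 by apply/val_kerP; exists t.
  exact: raddf0.
have Tk : presented k (submod (ker (ext_map i f))).
  by apply: (presented_iso (f := B)) Zk; exists A.
have ees := ext_map_surj (i := i) es; have eE := ext_map_exact (i := i) fE es.
have Lk : presented k (submod (ker (ext_map i e))).
  exact: presented_syzygy Kk (fg_free_ext i Ff) (ker_short_exact ees).
have [|q qE] := @factor_inj _ _ _ _ (val : {linear submod (ker (ext_map i e)) -> _})
    (ext_map i f) val_inj.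
  by move=> t; apply/val_kerP; apply/eE; exists t.
apply: (presented_extension
  (f := val : {linear submod (ker (ext_map i f)) -> _}) (g := q)) => //.
split; [exact: val_inj| |].
- move=> t; rewrite -val_kerP -qE.
  by split=> [->|t0]; rewrite ?raddf0 //; apply: val_inj.
- move=> t; have /eE[u uE] : ext_map i e (val t) = 0 by apply/val_kerP; exists t.
  by exists u; apply: val_inj; rewrite qE.
Qed.

(** * Induction along the syzygies of [M] *)

Section Main.
Variables (R R1 R2 R0 : comPzRingType).
Variables (i1 : {rmorphism R -> R1}) (i2 : {rmorphism R -> R2}).
Variables (j1 : {rmorphism R1 -> R0}) (j2 : {rmorphism R2 -> R0}).
Hypothesis pb : is_pullback i1 i2 j1 j2.
Hypothesis i1s : surj i1.

(** Induction on [d]: [K] stands for the [m]-th syzygy up to stable equivalence. Passing to the next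
    syzygy raises [m] and lowers [d], matching the shift in the [Tor] hypotheses; at the end finite
    generation descends. *)
Lemma presented_descent_syzygy (M : lmodType R) d : forall (K : lmodType R) m,
  stably_equivalent K (iter m (@syz R) M) -> presented d K ->
  presented d.+1 (ext i1 K) -> presented d.+1 (ext i2 K) ->
  (forall j, (j <= d)%N -> presented (d - j) (Tor i1 (m + j).+1 M)) ->
  (forall j, (j <= d)%N -> presented (d - j) (Tor i2 (m + j).+1 M)) ->
  presented d.+1 K.
Proof.
have step (S : comPzRingType) (i : {rmorphism R -> S}) m k
    (K' F K : lmodType R) (f : {linear K' -> F}) (e : {linear F -> K}) :
    fg_free F -> short_exact f e -> stably_equivalent K (iter m (@syz R) M) ->
    presented k.+1 (ext i K) ->
    (forall j, (j <= k)%N -> presented (k - j) (Tor i (m + j).+1 M)) ->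
    presented k (ext i K').
  (* One step uses [Tor] in degree [m.+1]; higher degrees serve the later steps. *)
  move=> Ff ex KZ Kk /(_ 0%N isT); rewrite subn0 addn0 => Tk.
  apply: (presented_ext_syzygy Ff ex KZ Kk).
  by have [h hb] := Tor_syzygy i m M; exact: presented_iso hb Tk.
elim: d => [|d IH] K m KZ Kd K1 K2 T1 T2.
  (* For [d = 0] any finite free cover works: its kernel has finitely generated base changes, hence
     is finitely generated. *)
  have /presented0P[F [e [Ff es]]] := Kd.
  have ex := ker_short_exact es.
  apply/presentedSP; exists F, (submod (ker e)), val, e; split=> //.
  apply: (generated_descent pb i1s).
    exact: (step _ _ _ _ _ _ _ _ _ Ff ex KZ K1 T1).
  exact: (step _ _ _ _ _ _ _ _ _ Ff ex KZ K2 T2).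
have /presentedSP[F [K' [f [e [Ff ex K'd]]]]] := Kd.
apply/presentedSP; exists F, K', f, e; split=> //.
apply: (IH K' m.+1) => //.
- exact: stably_equivalent_syzygy (fg_free_projective Ff)
    (@free_projective R _) ex (syz_short_exact _) KZ.
- exact: (step _ _ _ _ _ _ _ _ _ Ff ex KZ K1 T1).
- exact: (step _ _ _ _ _ _ _ _ _ Ff ex KZ K2 T2).
- by move=> j jd; rewrite addSnnS; exact: (T1 j.+1).
- by move=> j jd; rewrite addSnnS; exact: (T2 j.+1).
Qed.

End Main.

Theorem theorem3p3 (R R1 R2 R0 : comPzRingType)
    (i1 : {rmorphism R -> R1}) (i2 : {rmorphism R -> R2})
    (j1 : {rmorphism R1 -> R0}) (j2 : {rmorphism R2 -> R0})
    (n : nat) (X : lmodType R -> Prop)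
    (Y1 : lmodType R1 -> Prop) (Y2 : lmodType R2 -> Prop) :
  is_pullback i1 i2 j1 j2 ->
  (forall a : R1, exists r : R, i1 r = a) ->
  property_star X ->
  (forall (k : nat) (N : lmodType R),
     presented_in X k N -> presented_in Y1 k (ext i1 N)) ->
  (forall (k : nat) (N : lmodType R),
     presented_in X k N -> presented_in Y2 k (ext i2 N)) ->
  (forall M : lmodType R, presented_in X n M ->
     forall j : nat, (1 <= j <= n.+1)%N ->
       presented_in Y1 (n.+1 - j)%N (Tor i1 j M)) ->
  (forall M : lmodType R, presented_in X n M ->
     forall j : nat, (1 <= j <= n.+1)%N ->
       presented_in Y2 (n.+1 - j)%N (Tor i2 j M)) ->
  coherent n Y1 -> coherent n Y2 -> coherent n X.
Proof.
move=> pb i1s _ X1 X2 T1 T2 coh1 coh2 M XM; split; first exact: XM.1.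
(* [M] is its own zeroth syzygy, and coherence of [R1] and [R2] supplies the extra level of
   presentation of its base changes. *)
apply: (presented_descent_syzygy pb i1s (m := 0)) XM.2 _ _ _ _.
- exact: stably_equivalent_refl.
- exact: (coh1 _ (X1 _ _ XM)).2.
- exact: (coh2 _ (X2 _ _ XM)).2.
- by move=> j jn; exact: (T1 M XM j.+1 jn).2.
- by move=> j jn; exact: (T2 M XM j.+1 jn).2.
Qed.
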